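(* The optimal balking threshold $n_S$ for the problem $S^*=\max_{\underline n\le n_0\le\overline n}Z(n_0)$ is $$n_S=\max(\underline n,\min(\tilde n_S,\overline n)),$$ where $\tilde n_S=\min\{n_0:Y(n_0)<0\}$ and $$Y(n_0)=(G_{n_0}+B_{n_0})(\tilde d^S_{n_0})\sum_{n=0}^{n_0}\rho^n-\rho\sum_{n=0}^{n_0-1}\rho^n(G_n+B_n)(\tilde d^S_n).$$
   Context: Parameters: $\lambda,\mu>0$ (arrival and service rates of an observable M/M/1 system), $\rho=\lambda/\mu$; service value $R$, entrance fee $p$, waiting cost rate $c>0$, compensation rate $l$, risk-aversion coefficient $r>0$, with $0\le p\le R$ and $0\le l\le c$. For each integer $n\ge 0$, $X_n\sim Gamma(n+1,\mu)$ has density $\mu^{n+1}x^ne^{-\mu x}/n!$ on $(0,\infty)$. A lead-time quote is $d\in[0,\infty]$; $d=\infty$ means no compensation, with $(x-\infty)^+=0$. Expected utility of a joining customer who finds $n$ customers and is quoted $d$: $$B_n(d)=E\left[\frac{1-e^{-r(R-p-cX_n+l(X_n-d)^+)}}{r}\right]\in[-\infty,\infty).$$ The customer joins iff $B_n(d)\ge 0$. Let $L_n(d)=E(X_n-d)^+$, and let $G_n(d)=p-lL_n(d)$ if $B_n(d)\ge0$, $G_n(d)=0$ if $B_n(d)<0$. Put $\underline n=\inf\{n\ge0:\lim_{d\to\infty}B_n(d)<0\}$, $\overline n=\inf\{n\ge0:B_n(0)<0\}$ (with $\inf\varnothing=\infty$), $q(n;n_0)=\rho^n/\sum_{k=0}^{n_0}\rho^k$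 for $0\le n\le n_0$, and $\tilde d^P_n=\sup\{d\ge0:B_n(d)\ge0\}$ with $\sup\varnothing=-1$. For $n=0,1,\ldots,\overline n-1$, $\tilde d^S_n$ denotes the optimal lead-time that induces a customer to join in state $n$, i.e. the lead-time maximizing $G_n(d)+B_n(d)$ over $d\in[0,\tilde d^P_n]$; $Y(n_0)$ is considered for those $n_0$ for which $\tilde d^S_{n_0}$ is defined, with $\min\varnothing=\infty$. For an integer $n_0$ with $\underline n\le n_0\le\overline n$, $Z(n_0)$ is the supremum of the social benefit per unit time $\lambda\sum_{n=0}^{n_0-1}q(n;n_0)(G_n(d_n)+B_n(d_n))$ over all vectors $(d_0,\ldots,d_{n_0})$ of nonnegative quotes with $B_n(d_n)\ge0$ for $n=0,\ldots,n_0-1$ and $B_{n_0}(d_{n_0})<0$ (so that $n_0$ is the balking threshold). *)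

(* Defs.v *)
(* MathComp / MathComp-Analysis. *)
From HB Require Import structures.
From mathcomp Require Import all_boot all_order all_algebra.
From mathcomp Require Import all_classical all_reals all_analysis.

Set Implicit Arguments.
Unset Strict Implicit.
Unset Printing Implicit Defensive.

Import Order.TTheory GRing.Theory Num.Theory.
Import numFieldNormedType.Exports.

Local Open Scope classical_set_scope.
Local Open Scope ring_scope.

Section gamma.
Context {R : realType}.

(* Gamma(n+1, mu) *)
Definition gamma_pdf (n : nat) (mu : R) : R -> R :=
  (fun x => mu ^+ n.+1 * x ^+ n * expR (- mu * x) / n`!%:R) \_ `]0, +oo[.

Definition gamma_prob (n : nat) (mu : R) : set R -> \bar R :=
  fun V => (\int[lebesgue_measure]_(x in V) (gamma_pdf n mu x)%:E)%E.

End gamma.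

(* (x - d)^+ for a quote d in [0, +oo]; at d = +oo it is max(-oo, 0) = 0. *)
Definition excess {R : realType} (x : R) (d : \bar R) : R :=
  fine (maxe (x%:E - d) 0)%E.

(* inf {n | Q n} as an extended real; +oo when no n satisfies Q. *)
Definition nat_inf {R : realType} (Q : nat -> Prop) : \bar R :=
  ereal_inf [set (n%:R : R)%:E | n in [set n | Q n]].

(* [X n] is the sojourn time of a customer who finds n customers, [Rv] the
   value of service, [p] the fee, [c] the waiting cost rate, [l] the
   compensation rate, [r] the risk aversion. *)
Section quotes.
Context {disp : measure_display} {T : measurableType disp} {R : realType}.
Variables (P : probability T R) (X : nat -> {RV P >-> R}).
Variables (Rv p c l r : R).

Local Open Scope ereal_scope.

(* The integrand is bounded above on X n >= 0, so the expectation lies in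
   [-oo, +oo[; it is -oo when the negative part is not integrable. *)
Definition B (n : nat) (d : \bar R) : \bar R :=
  'E_P[fun w =>
    ((1 - expR (- r * (Rv - p - c * X n w + l * excess (X n w) d))) / r)%R].

Definition L (n : nat) (d : \bar R) : \bar R :=
  'E_P[fun w => excess (X n w) d].

Definition G (n : nat) (d : \bar R) : \bar R :=
  if 0 <= B n d then p%:E - l%:E * L n d else 0.

Definition n_under : \bar R :=
  nat_inf (fun n => lim (B n x%:E @[x --> +oo%R]) < 0).

Definition n_over : \bar R := nat_inf (fun n => B n 0 < 0).

Definition accepted (n : nat) : set (\bar R) :=
  [set d | 0 <= d /\ 0 <= B n d].

Definition dP (n : nat) : \bar R :=
  if accepted n == set0 then (-1)%:E else ereal_sup (accepted n).

Definition is_dS (n : nat) (d : \bar R) : Prop :=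
  0 <= d <= dP n /\
  forall d', 0 <= d' <= dP n -> G n d' + B n d' <= G n d + B n d.

Variable rho : R.

Definition q (n n0 : nat) : R := (rho ^+ n / \sum_(k < n0.+1) rho ^+ k)%R.

(* Only the coordinates d 0, ..., d n0 matter: the vector (d_0, ..., d_n0) is
   encoded by any sequence extending it. *)
Definition induces_threshold (n0 : nat) (d : nat -> \bar R) : Prop :=
  [/\ forall n, (n <= n0)%N -> 0 <= d n,
      forall n, (n < n0)%N -> 0 <= B n (d n)
    & B n0 (d n0) < 0].

Definition social_benefit (lam : R) (n0 : nat) (d : nat -> \bar R) : \bar R :=
  lam%:E * \sum_(n < n0) (q n n0)%:E * (G n (d n) + B n (d n)).

Definition Z (lam : R) (n0 : nat) : \bar R :=
  ereal_sup [set social_benefit lam n0 d | d in induces_threshold n0].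

Definition feasible_threshold (n0 : nat) : Prop :=
  n_under <= (n0%:R)%:E <= n_over.

Definition is_optimal_threshold (lam : R) (n0 : nat) : Prop :=
  feasible_threshold n0 /\
  forall m, feasible_threshold m -> Z lam m <= Z lam n0.

Variable dS : nat -> \bar R.

Definition Y (n0 : nat) : \bar R :=
  (G n0 (dS n0) + B n0 (dS n0)) * (\sum_(n < n0.+1) rho ^+ n)%R%:E
  - rho%:E * \sum_(n < n0) (rho ^+ n)%:E * (G n (dS n) + B n (dS n)).

(* dS n0 is defined only for n0 < n_over, so the minimum ranges over those. *)
Definition n_tilde : \bar R :=
  nat_inf (fun n0 => (n0%:R)%:E < n_over /\ Y n0 < 0).

Definition n_S : \bar R := maxe n_under (mine n_tilde n_over).

End quotes.

(* Main.v *)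
Require Import Defs.
From HB Require Import structures.
From mathcomp Require Import all_boot all_order all_algebra.
From mathcomp Require Import all_classical all_reals all_analysis.
From mathcomp Require Import measurable_realfun ring lra.

Import Order.TTheory GRing.Theory Num.Theory.
Import numFieldNormedType.Exports.

Local Open Scope classical_set_scope.
Local Open Scope ring_scope.

(** The benefit rate of a threshold is a ratio of sums, and its increments have
    the sign of [Y].  Let [a n] be the largest value of [G n d + B n d] over the
    accepted quotes, [S m] the sum of [rho ^+ k] for [k <= m] and [T m] the sum
    of [rho ^+ k * a k] for [k < m].  States below a feasible threshold [m] can
    be optimised separately, and state [m] can be made to balk by offering no
    compensation, so [Z m = lam * T m / S m] ([ZE]).  Cross-multiplying,
    [T m.+1 / S m.+1 - T m / S m] is a positive multiple of
    [a m * S m - rho * T m = Y m] ([rate_step]).  Moreover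
    [Y m.+1 - Y m = (a m.+1 - a m) * S m.+1] ([marginal_step]), so if [a] is
    nonincreasing then [Y] changes sign at most once, the benefit rate first
    grows and then decreases, and the best feasible threshold is the turning
    point of the rate clamped to the feasible interval.

    That [a] is nonincreasing ([best_welfare_anti]) comes from stochastic
    dominance: as [l <= c], both the compensation and the customer's net cost
    are nondecreasing in the sojourn time, and gamma variables increase
    stochastically with their shape ([gamma_stochastic_le]); hence a quote
    accepted in state [n.+1] is accepted in state [n] and yields at least as
    much there.

    Everything about [B] is read off the nonnegative function
    [loss d x = exp (- r * (surplus)) / r], for which
    [B n d = 1 / r - E (loss d (X n))] holds even if the mean is infinite
    ([B_loss]).  Three consequences matter.  The supremum of the accepted quotes
    is itself accepted ([B_ge0_left_closed], [dP_accepted]).  The limit of [B n]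
    at infinity is negative exactly if its value without compensation is
    ([limB_lt0]).  Finally, the inequality [1 + y <= exp y] bounds the mean loss
    from below ([mean_loss_lower]); this makes [n_under] finite
    ([B_pinfty_lt0]), and bounds the welfare by a constant minus
    [c * (n + 1) / mu] ([welfare_upper]), so that [Y] is eventually negative if
    every customer can be induced to join. *)

(** * Integrals with densities and of functions bounded above *)

Section density.
Local Open Scope ereal_scope.
Context {d} {T : measurableType d} {R : realType}.
Variables (mu nu : {measure set T -> \bar R}) (g : T -> R).
Hypotheses (mg : measurable_fun [set: T] g) (g0 : forall x, (0 <= g x)%R).
Hypothesis nuE : forall A, measurable A -> nu A = \int[mu]_(x in A) (g x)%:E.

Import HBNNSimple.

Let integral_density_nnsfun (f : {nnsfun T >-> R}) :
  \int[nu]_x (f x)%:E = \int[mu]_x ((f x)%:E * (g x)%:E).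
Proof.
under eq_integral do rewrite fimfunE -fsumEFin//.
rewrite ge0_integral_fsum//; last 2 first.
  - by move=> r; exact/measurable_EFinP/measurableT_comp.
  - by move=> n x _; rewrite EFinM nnfun_muleindic_ge0.
under [RHS]eq_integral.
  move=> x _; rewrite fimfunE -fsumEFin// muleC ge0_mule_fsumr; last first.
    by move=> r; rewrite EFinM nnfun_muleindic_ge0.
  over.
rewrite [RHS]ge0_integral_fsum//; last 2 first.
  - move=> r; apply: emeasurable_funM; first exact/measurable_EFinP.
    exact/measurable_EFinP/measurableT_comp.
  - move=> r x _; apply: mule_ge0; first by rewrite lee_fin.
    by rewrite EFinM nnfun_muleindic_ge0.
apply: eq_fsbigr => r _.
rewrite integralZl_indic_nnsfun//= integral_indic// setIT nuE//.
have [->|rf] := eqVneq (f @^-1` [set r]) set0.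
  rewrite integral_set0 mule0 integral0_eq// => x _.
  by rewrite indic0 mulr0 mule0.
have r0 : (0 <= r)%R by have /set0P[x <-] := rf; exact: fun_ge0.
rewrite integral_mkcond -ge0_integralZl//; last 2 first.
  exact/(measurable_restrictT _ _).1/measurable_funTS/measurable_EFinP.
  by move=> x _; apply: erestrict_ge0 => y _; rewrite lee_fin.
apply: eq_integral => x _; rewrite patchE indicE.
by case: ifPn => xf; rewrite ?mulr1 ?mulr0 ?mule0 1?muleC.
Qed.

(** For an indicator this is the hypothesis on [nu]; linearity extends it to
    simple functions, and monotone convergence to nonnegative ones. *)
Lemma ge0_integral_density (f : T -> \bar R) :
  measurable_fun [set: T] f -> (forall x, 0 <= f x) ->
  \int[nu]_x f x = \int[mu]_x (f x * (g x)%:E).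
Proof.
move=> mf f0.
pose f_ := nnsfun_approx measurableT mf.
transitivity (limn (fun n => \int[nu]_x (f_ n x)%:E)).
  rewrite -monotone_convergence//=.
  - apply: eq_integral => x _; apply/esym/cvg_lim => //=.
    exact: cvg_nnsfun_approx.
  - by move=> n; exact/measurable_EFinP/measurable_funTS.
  - by move=> n ? _; rewrite lee_fin.
  - by move=> ? _ ? ? mn; rewrite lee_fin; exact/lefP/nd_nnsfun_approx.
transitivity (limn (fun n => \int[mu]_x ((f_ n x)%:E * (g x)%:E))); last first.
  rewrite -monotone_convergence//=.
  - apply: eq_integral => x _; apply/cvg_lim => //=.
    apply: cvgeZr => //; exact: cvg_nnsfun_approx.
  - by move=> n; apply: emeasurable_funM; exact/measurable_EFinP.
  - by move=> n ? _; rewrite mule_ge0// lee_fin.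
  - move=> x _ m n mn; rewrite lee_wpmul2r// lee_fin//.
    exact/lefP/nd_nnsfun_approx.
by apply: congr_lim; apply/funext => n; exact: integral_density_nnsfun.
Qed.

End density.

(** If [g] has infinite mean, then so has the negative part of [a - g], and both
    sides are [-oo]. *)
Lemma integral_cstB {d} {T : measurableType d} {R : realType}
    (P : probability T R) (a : R) (g : T -> R) :
  measurable_fun [set: T] g -> (forall w, 0 <= g w) ->
  (\int[P]_w (a - g w)%:E = a%:E - \int[P]_w (g w)%:E)%E.
Proof.
move=> mg g0.
have mge : measurable_fun [set: T] (EFin \o g) by exact/measurable_EFinP.
have mag : measurable_fun [set: T] (fun w => (a - g w)%:E).
  exact/measurable_EFinP/measurable_funB.
have [goo|gfin] := eqVneq (\int[P]_w (g w)%:E)%E +oo%E.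
  rewrite goo addeNy integralE.
  suff -> : (\int[P]_w (fun w => (a - g w)%:E)^\- w = +oo)%E by rewrite addeNy.
  apply/eqP; rewrite -leye_eq -goo leNgt; apply/negP => neg_lt.
  suff : (\int[P]_w (g w)%:E < +oo)%E by rewrite goo.
  apply: (@le_lt_trans _ _
    (\int[P]_w (`|a|%:E + (fun w => (a - g w)%:E)^\- w))%E).
    apply: ge0_le_integral => //.
    - by move=> w _; rewrite lee_fin.
    - by apply: emeasurable_funD => //; exact: measurable_funeneg.
    - move=> w _; rewrite funenegE -EFinN -EFin_max -EFinD lee_fin.
      by rewrite -lerBlDl le_max opprB lerB// ler_norm.
  rewrite ge0_integralD//; last exact: measurable_funeneg.
  by rewrite integral_cst//= probability_setT mule1 lte_add_pinfty// ?ltry -?goo.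
have gint : P.-integrable [set: T] (EFin \o g).
  apply/integrableP; split => //.
  under eq_integral => w _ do rewrite /= ger0_norm//.
  by rewrite ltey.
have := @integralB_EFin _ _ _ P _ (cst a) g measurableT
  (finite_measure_integrable_cst P a measurableT) gint.
by move=> ->; rewrite /= integral_cst//= probability_setT mule1.
Qed.

(** * Gamma laws and their stochastic order *)

Section gamma_law.
Context {R : realType} (mu : R).
Hypothesis mu_gt0 : 0 < mu.

Lemma gamma_pdf_ge0 n x : 0 <= gamma_pdf n mu x.
Proof.
rewrite /gamma_pdf patchE; case: ifPn => //; rewrite inE/= in_itv/= andbT => x0.
by rewrite !mulr_ge0// ?exprn_ge0 ?invr_ge0// ?expR_ge0 ltW.
Qed.

Lemma measurable_gamma_pdf n : measurable_fun [set: R] (gamma_pdf n mu).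
Proof.
apply/(measurable_restrictT _ _).1 => //.
apply: measurable_funTS; apply: measurable_funM => //.
apply: measurable_funM; first exact: measurable_funM.
by apply: measurableT_comp => //; exact: measurable_funM.
Qed.

Lemma gamma_pdfS n x : 0 < x ->
  gamma_pdf n.+1 mu x = mu * x / n.+1%:R * gamma_pdf n mu x.
Proof.
move=> x0; rewrite /gamma_pdf !patchE.
have -> : x \in (`]0, +oo[%classic : set R) by rewrite inE/= in_itv/= x0.
rewrite factS natrM !exprS; field.
by rewrite addrC natr1 !pnatr_eq0 -lt0n fact_gt0.
Qed.

Context {d} {T : measurableType d} (P : probability T R)
  (X : nat -> {RV P >-> R}).
Hypothesis X_gamma : forall (n : nat) (A : set R), measurable A ->
  distribution P (X n) A = gamma_prob n mu A.

Local Notation leb := (@lebesgue_measure R).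

Lemma expectation_gamma n (h : R -> R) :
  measurable_fun [set: R] h -> (forall x, 0 <= h x) ->
  (\int[P]_w (h (X n w))%:E = \int[leb]_x (h x * gamma_pdf n mu x)%:E)%E.
Proof.
move=> mh h0.
have mhe : measurable_fun [set: R] (EFin \o h) by exact/measurable_EFinP.
(* The Lebesgue measure lives on a copy of [R] whose measurable sets are the
   same; the law of [X n] is moved there. *)
pose GR := measurableTypeR R.
have mXn : measurable_fun [set: T] (X n : T -> GR).
  by move=> mT A mA; exact: (@measurable_funPT _ _ _ _ (X n) mT A mA).
pose Xn : {mfun T >-> GR} :=
  HB.pack (X n : T -> GR) (isMeasurableFun.Build _ _ _ _ _ mXn).
transitivity (\int[distribution P Xn]_x (h x)%:E)%E.
  by rewrite ge0_integral_distribution// => x; rewrite lee_fin.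
rewrite (@ge0_integral_density _ GR R leb (distribution P Xn)
  (gamma_pdf n mu))//.
- exact: measurable_gamma_pdf.
- exact: gamma_pdf_ge0.
- exact: X_gamma.
Qed.

(** The normalisation of every gamma density is obtained from the existence of
    a random variable with that law. *)
Lemma integral_gamma_pdf n : (\int[leb]_x (gamma_pdf n mu x)%:E = 1)%E.
Proof.
transitivity (\int[P]_w (cst 1%R (X n w))%:E)%E.
  by rewrite expectation_gamma//; apply: eq_integral => x _; rewrite mul1r.
have := @integral_cst _ _ _ P [set: T] measurableT 1%E.
by rewrite /= probability_setT mule1.
Qed.

(** Multiplying the density by [x] gives, up to the factor [n.+1 / mu], the
    density with the next shape parameter, whose integral is one. *)
Lemma mean_gamma n :
  (\int[P]_w (Num.max (X n w) 0)%:E = (n.+1%:R / mu)%:E)%E.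
Proof.
rewrite (@expectation_gamma n (fun x => Num.max x 0)); last 2 first.
- exact: measurable_funrpos.
- by move=> x; rewrite le_max lexx orbT.
transitivity (\int[leb]_x ((n.+1%:R / mu)%:E * (gamma_pdf n.+1 mu x)%:E))%E.
  apply: eq_integral => x _; rewrite -EFinM; congr EFin.
  have [x0|x0] := ltP 0 x.
    rewrite gamma_pdfS//; field.
    by rewrite addrC natr1 pnatr_eq0 /= gt_eqF.
  suff p0 m : gamma_pdf m mu x = 0 by rewrite !p0 !mulr0.
  by rewrite /gamma_pdf patchE memNset//= in_itv/= andbT ltNge x0.
rewrite ge0_integralZl_EFin ?integral_gamma_pdf ?mule1//.
- by move=> x _; rewrite lee_fin gamma_pdf_ge0.
- by apply/measurable_EFinP; exact: measurable_gamma_pdf.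
- by rewrite divr_ge0// ltW.
Qed.

(** The densities of shapes [n.+1] and [n.+2] cross exactly once, at
    [x0 = n.+1 / mu], so for nondecreasing [h] the product of [h x - h x0] and
    of the difference of the densities is nonnegative everywhere; integrating it
    and cancelling [h x0], the densities having equal mass, gives the result. *)
Lemma gamma_stochastic_le n (h : R -> R) :
  {homo h : x y / x <= y} -> (forall x, 0 <= h x) ->
  (\int[P]_w (h (X n w))%:E <= \int[P]_w (h (X n.+1 w))%:E)%E.
Proof.
move=> hm h0.
have mh : measurable_fun [set: R] h.
  by apply: nondecreasing_measurable => // x y _ _; exact: hm.
rewrite !expectation_gamma//.
set x0 := n.+1%:R / mu.
have mg m (f : R -> R) : measurable_fun [set: R] f ->
    measurable_fun [set: R] (fun x => (f x * gamma_pdf m mu x)%:E).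
  move=> mf; apply/measurable_EFinP; apply: measurable_funM => //.
  exact: measurable_gamma_pdf.
have g0 m (f : R -> R) : (forall x, 0 <= f x) -> forall x,
    [set: R] x -> (0 <= (f x * gamma_pdf m mu x)%:E)%E.
  by move=> f0 x _; rewrite lee_fin mulr_ge0// gamma_pdf_ge0.
have cstE m : (\int[leb]_x (h x0 * gamma_pdf m mu x)%:E = (h x0)%:E)%E.
  under eq_integral => x _ do rewrite EFinM.
  rewrite ge0_integralZl_EFin ?integral_gamma_pdf ?mule1//.
  - by move=> x _; rewrite lee_fin gamma_pdf_ge0.
  - by apply/measurable_EFinP; exact: measurable_gamma_pdf.
rewrite -(@leeD2rE _ (h x0)%:E)// -{1}(cstE n.+1) -(cstE n).
rewrite -!ge0_integralD//; try by [exact: mg | exact: g0].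
- apply: ge0_le_integral => //.
  + by move=> x _; rewrite adde_ge0//; exact: g0.
  + by apply: emeasurable_funD; exact: mg.
  + by apply: emeasurable_funD; exact: mg.
  move=> x _; rewrite -!EFinD lee_fin -subr_ge0.
  set p0 := gamma_pdf n mu x; set p1 := gamma_pdf n.+1 mu x.
  rewrite (_ : _ - _ = (h x - h x0) * (p1 - p0)); last by ring.
  have [x_gt0|x_le0] := ltP 0 x; last first.
    suff pE m : gamma_pdf m mu x = 0 by rewrite /p1 /p0 !pE subrr mulr0.
    by rewrite /gamma_pdf patchE memNset//= in_itv/= andbT ltNge x_le0.
  rewrite (_ : p1 - p0 = mu / n.+1%:R * p0 * (x - x0)); last first.
    rewrite /p1 gamma_pdfS// -/p0 /x0; field.
    by rewrite addrC natr1 pnatr_eq0 /= gt_eqF.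
  rewrite mulrCA mulr_ge0//.
    by rewrite mulr_ge0 ?gamma_pdf_ge0// divr_ge0// ltW.
  have [xx0|/ltW xx0] := leP x0 x.
    by rewrite mulr_ge0 ?subr_ge0// hm.
  by rewrite mulr_le0 ?subr_le0// hm.
Qed.

End gamma_law.

(** * Compensation and disutility of a sojourn time *)

Section excess.
Context {R : realType}.
Implicit Types (x y : R) (d : \bar R).

Lemma excess_EFin x (t : R) : excess x t%:E = Num.max (x - t) 0.
Proof. by rewrite /excess -EFinN -EFinD -EFin_max. Qed.

Lemma excess_pinfty x : excess x +oo%E = 0.
Proof. by rewrite /excess /= addeNy maxNye. Qed.

Lemma excess_minfty x : excess x -oo%E = 0.
Proof. by rewrite /excess (_ : (x%:E - -oo)%E = +oo%E)// maxye. Qed.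

Lemma excess_ge0 x d : 0 <= excess x d.
Proof.
case: d => [t||]; rewrite ?excess_EFin ?excess_pinfty ?excess_minfty//.
by rewrite le_max lexx orbT.
Qed.

Lemma excess_homo d : {homo excess^~ d : x y / x <= y}.
Proof.
move=> x y xy; case: d => [t||];
  rewrite ?excess_EFin ?excess_pinfty ?excess_minfty//.
by rewrite ge_max !le_max lerD2r xy lexx orbT.
Qed.

Lemma excess_lip x y d : x <= y -> excess y d - excess x d <= y - x.
Proof.
move=> xy.
case: d => [t||];
  rewrite ?excess_EFin ?excess_pinfty ?excess_minfty ?subrr ?subr_ge0//.
by case: (leP (y - t) 0); case: (leP (x - t) 0); lra.
Qed.

Lemma excess_anti x d d' : (-oo < d)%E -> (d <= d')%E ->
  excess x d' <= excess x d.
Proof.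
case: d => [t _||//]; last by rewrite leye_eq => _ /eqP ->.
case: d' => [t'||]; rewrite ?excess_pinfty ?excess_ge0// lee_fin => tt'.
by rewrite !excess_EFin ge_max !le_max lerD2l lerN2 tt' lexx orbT.
Qed.

Lemma excess_le_pos x d : (0 <= d)%E -> excess x d <= Num.max x 0.
Proof.
move=> d0; have := @excess_anti x 0%E d (ltNye _) d0.
by rewrite excess_EFin subr0.
Qed.

End excess.

Section loss.
Context {R : realType} (Rv p c l r : R).
Hypotheses (c_gt0 : 0 < c) (r_gt0 : 0 < r) (pRv : p <= Rv)
  (l_ge0 : 0 <= l) (l_le_c : l <= c).
Implicit Types (x y : R) (d : \bar R).

(** The customer's exponential disutility: the utility of a sojourn time [x] is
    [r^-1 - loss d x]. *)
Definition loss d x : R :=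
  expR (- r * (Rv - p - c * x + l * excess x d)) / r.

Lemma loss_ge0 d x : 0 <= loss d x.
Proof. by rewrite /loss divr_ge0 ?expR_ge0// ltW. Qed.

(** One more unit of waiting costs [c] and brings at most [l <= c] back. *)
Lemma loss_homo d : {homo loss d : x y / x <= y}.
Proof.
move=> x y xy; rewrite /loss ler_pM2r ?invr_gt0// ler_expR.
rewrite !mulNr lerN2 ler_pM2l//.
have := ler_wpM2l l_ge0 (excess_lip _ _ d xy).
have : l * (y - x) <= c * (y - x) by rewrite ler_wpM2r// subr_ge0.
by lra.
Qed.

Lemma measurable_loss d : measurable_fun [set: R] (loss d).
Proof. by apply: nondecreasing_measurable => //; exact: loss_homo. Qed.

Lemma loss_quote_homo x d d' : (-oo < d)%E -> (d <= d')%E ->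
  loss d x <= loss d' x.
Proof.
move=> d_fin dd'; rewrite /loss ler_pM2r ?invr_gt0// ler_expR.
rewrite !mulNr lerN2 ler_pM2l// lerD2l ler_wpM2l//.
exact: excess_anti.
Qed.

(** Shortening the quote by [e] raises the compensation by at most [l * e]. *)
Lemma loss_shift x (t e : R) : 0 <= e ->
  loss t%:E x <= expR (r * l * e) * loss (t - e)%:E x.
Proof.
move=> e0; rewrite /loss mulrA ler_pM2r ?invr_gt0// -expRD ler_expR.
rewrite !excess_EFin.
suff : Num.max (x - (t - e)) 0 <= Num.max (x - t) 0 + e.
  by move=> /(ler_wpM2l (mulr_ge0 (ltW r_gt0) l_ge0)); lra.
by rewrite ge_max; case: (leP (x - t) 0); lra.
Qed.

(** This is [1 + y <= exp y] at the exponent of [loss]; the positive part is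
    taken so that all the terms can be integrated as nonnegative functions. *)
Lemma loss_lower x d :
  c * Num.max x 0 <= loss d x + (l * excess x d + (Rv - p)).
Proof.
have := excess_ge0 x d; set e := excess x d => e0.
have le0 : 0 <= l * e by rewrite mulr_ge0.
have L0 := loss_ge0 d x.
have [x0|x0] := leP x 0; first by move: pRv L0 le0; lra.
suff : r^-1 - (Rv - p - c * x + l * e) <= loss d x.
  have : 0 < r^-1 by rewrite invr_gt0.
  by lra.
rewrite /loss -/e ler_pdivlMr// mulrBl mulVf ?gt_eqF//.
by apply: le_trans (expR_ge1Dx _); lra.
Qed.

(** A quote that is not exceeded pays nothing. *)
Lemma loss_pinfty x d : (x%:E <= d)%E -> loss d x = loss +oo%E x.
Proof.
move=> xd; rewrite /loss excess_pinfty; suff -> : excess x d = 0 by [].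
move: d xd => [t||]; rewrite ?excess_pinfty// ?leeNy_eq// lee_fin => xt.
by rewrite excess_EFin max_r// subr_le0.
Qed.

End loss.

(** * Ratios of geometric sums *)

Section benefit_rate.
Context {R : realType} (rho : R) (a : nat -> R).
Hypothesis rho_gt0 : 0 < rho.

(** For [a n] the best welfare in state [n], the threshold [n] earns
    [geom_total n / geom_weight n] per arrival, and [geom_marginal n] is
    [Y n]. *)
Definition geom_weight n : R := \sum_(k < n.+1) rho ^+ k.

Definition geom_total n : R := \sum_(k < n) rho ^+ k * a k.

Definition geom_marginal n : R := a n * geom_weight n - rho * geom_total n.

Lemma geom_weightS n : geom_weight n.+1 = geom_weight n + rho ^+ n.+1.
Proof. by rewrite /geom_weight big_ord_recr. Qed.

Lemma geom_totalS n : geom_total n.+1 = geom_total n + rho ^+ n * a n.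
Proof. by rewrite /geom_total big_ord_recr. Qed.

Lemma geom_weight_ge1 n : 1 <= geom_weight n.
Proof.
rewrite /geom_weight big_ord_recl expr0 lerDl sumr_ge0// => k _.
by rewrite exprn_ge0// ltW.
Qed.

Lemma geom_weight_gt0 n : 0 < geom_weight n.
Proof. exact: lt_le_trans ltr01 (geom_weight_ge1 n). Qed.

Lemma rate_step n :
  geom_total n.+1 / geom_weight n.+1 - geom_total n / geom_weight n =
  rho ^+ n * geom_marginal n / (geom_weight n * geom_weight n.+1).
Proof.
have wn := gt_eqF (geom_weight_gt0 n); have := gt_eqF (geom_weight_gt0 n.+1).
rewrite geom_totalS geom_weightS exprS /geom_marginal => wS; field.
by rewrite wn wS.
Qed.

Lemma rate_le m n : (m <= n)%N ->
  (forall k, (m <= k < n)%N -> 0 <= geom_marginal k) ->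
  geom_total m / geom_weight m <= geom_total n / geom_weight n.
Proof.
elim: n => [|n IH]; first by rewrite leqn0 => /eqP->.
rewrite leq_eqVlt => /predU1P[->//|]; rewrite ltnS => mn marg.
apply: (@le_trans _ _ (geom_total n / geom_weight n)).
  by apply: IH => // k /andP[mk kn]; apply: marg; rewrite mk leqW.
rewrite -subr_ge0 rate_step divr_ge0// ?mulr_ge0// ?exprn_ge0//;
  rewrite ?(ltW (geom_weight_gt0 _)) ?(ltW rho_gt0)//.
by apply: marg; rewrite mn leqnn.
Qed.

Lemma rate_ge m n : (m <= n)%N ->
  (forall k, (m <= k < n)%N -> geom_marginal k <= 0) ->
  geom_total n / geom_weight n <= geom_total m / geom_weight m.
Proof.
elim: n => [|n IH]; first by rewrite leqn0 => /eqP->.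
rewrite leq_eqVlt => /predU1P[->//|]; rewrite ltnS => mn marg.
apply: (@le_trans _ _ (geom_total n / geom_weight n)); last first.
  by apply: IH => // k /andP[mk kn]; apply: marg; rewrite mk leqW.
rewrite -subr_le0 rate_step mulr_le0_ge0//; last first.
  by rewrite invr_ge0 mulr_ge0// ltW ?geom_weight_gt0.
rewrite mulr_ge0_le0 ?exprn_ge0 ?(ltW rho_gt0)//.
by apply: marg; rewrite mn leqnn.
Qed.

Lemma marginal_step n :
  geom_marginal n.+1 - geom_marginal n = (a n.+1 - a n) * geom_weight n.+1.
Proof. by rewrite /geom_marginal geom_totalS !geom_weightS exprS; ring. Qed.

Lemma marginal_anti m n : (m <= n)%N ->
  (forall k, (k < n)%N -> a k.+1 <= a k) -> geom_marginal n <= geom_marginal m.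
Proof.
elim: n => [|n IH]; first by rewrite leqn0 => /eqP->.
rewrite leq_eqVlt => /predU1P[->//|]; rewrite ltnS => mn a_anti.
apply: (@le_trans _ _ (geom_marginal n)); last first.
  by apply: IH => // k kn; apply: a_anti; rewrite leqW.
rewrite -subr_le0 marginal_step mulr_le0_ge0 ?subr_le0 ?a_anti//.
by rewrite ltW ?geom_weight_gt0.
Qed.

(** Summing [marginal_step] with weights at least one, the decrease of the
    marginal dominates that of [a], and both start at [a 0]. *)
Lemma marginal_le n :
  (forall k, (k < n)%N -> a k.+1 <= a k) -> geom_marginal n <= a n.
Proof.
elim: n => [|n IH] a_anti.
  rewrite /geom_marginal /geom_total big_ord0 mulr0 subr0.
  by rewrite /geom_weight big_ord1 expr0 mulr1.
have := IH (fun k kn => a_anti k (leqW kn)).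
have := marginal_step n; have := a_anti n (leqnn _).
have := geom_weight_ge1 n.+1.
nra.
Qed.

End benefit_rate.

Section nat_inf.
Context {R : realType}.

Lemma nat_infP (Q : nat -> Prop) :
  (exists n, [/\ nat_inf Q = (n%:R : R)%:E, Q n & forall m, Q m -> (n <= m)%N])
  \/ ((nat_inf Q = +oo :> \bar R)%E /\ forall n, ~ Q n).
Proof.
have [[n0 Qn0]|noQ] := pselect (exists n, Q n); last first.
  right; split; last by move=> n Qn; apply: noQ; exists n.
  rewrite /nat_inf; apply/ereal_inf_pinfty => _ [n Qn <-].
  by case: noQ; exists n.
left; have exQ : exists n, `[< Q n >] by exists n0; apply/asboolP.
case: (ex_minnP exQ) => n /asboolP Qn n_min.
have {}n_min m : Q m -> (n <= m)%N by move=> Qm; apply: n_min; apply/asboolP.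
exists n; split=> //; apply/eqP; rewrite eq_le; apply/andP; split.
  by apply: ereal_inf_lbound; exists n.
apply: le_ereal_inf_tmp => _ [m Qm <-]; rewrite lee_fin ler_nat.
exact: n_min.
Qed.

Lemma nat_inf_le (Q : nat -> Prop) n : Q n -> (nat_inf Q <= (n%:R : R)%:E)%E.
Proof. by move=> Qn; apply: ereal_inf_lbound; exists n. Qed.

Lemma lt_nat_inf (Q : nat -> Prop) n : ((n%:R : R)%:E < nat_inf Q)%E -> ~ Q n.
Proof. by move=> /[swap] /nat_inf_le; rewrite leNgt => /negP. Qed.

End nat_inf.

(** * Joining decisions and optimal threshold *)

Section queue.
Context {disp : measure_display} {T : measurableType disp} {R : realType}
  (P : probability T R) (X : nat -> {RV P >-> R}) (mu Rv p c l r : R).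
Hypotheses (mu_gt0 : 0 < mu) (c_gt0 : 0 < c) (r_gt0 : 0 < r) (pRv : p <= Rv)
  (l_ge0 : 0 <= l) (l_le_c : l <= c).
Hypothesis X_gamma : forall (n : nat) (A : set R), measurable A ->
  distribution P (X n) A = gamma_prob n mu A.

Local Open Scope ereal_scope.

Local Notation B := (B X Rv p c l r).
Local Notation L := (L X).
Local Notation G := (G X Rv p c l r).
Local Notation loss := (loss Rv p c l r).

Definition mean_loss n d : \bar R := \int[P]_w (loss d (X n w))%:E.

Lemma measurable_loss_X n d :
  measurable_fun [set: T] (fun w => (loss d (X n w))%:E).
Proof.
apply/measurable_EFinP; apply: measurableT_comp => //.
exact: measurable_loss.
Qed.

Lemma measurable_excess_X n d :
  measurable_fun [set: T] (fun w => (excess (X n w) d)%:E).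
Proof.
apply/measurable_EFinP; apply: (@measurableT_comp _ _ _ _ _ _ (excess^~ d)) => //.
by apply: nondecreasing_measurable => //; exact: excess_homo.
Qed.

Lemma B_loss n d : B n d = (r^-1)%:E - mean_loss n d.
Proof.
rewrite /Defs.B unlock -integral_cstB; last 2 first.
- exact/measurable_EFinP/measurable_loss_X.
- by move=> w; exact: loss_ge0.
by apply: eq_integral => w _; rewrite mulrBl mul1r.
Qed.

Lemma LE n d : L n d = \int[P]_w (excess (X n w) d)%:E.
Proof. by rewrite /Defs.L unlock. Qed.

Lemma mean_loss_ge0 n d : 0 <= mean_loss n d.
Proof. by apply: integral_ge0 => w _; rewrite lee_fin loss_ge0. Qed.

Lemma B_ge0 n d : (0 <= B n d) = (mean_loss n d <= (r^-1)%:E).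
Proof.
rewrite B_loss; have := mean_loss_ge0 n d; case: (mean_loss n d) => // t _.
by rewrite -EFinB !lee_fin subr_ge0.
Qed.

Lemma mean_loss_stochastic n d : mean_loss n d <= mean_loss n.+1 d.
Proof.
apply: (gamma_stochastic_le mu) => //; first exact: loss_homo.
by move=> x; exact: loss_ge0.
Qed.

Lemma B_anti_state n d : B n.+1 d <= B n d.
Proof. by rewrite !B_loss leeB// mean_loss_stochastic. Qed.

Lemma B_anti_quote n d d' : -oo < d -> d <= d' -> B n d' <= B n d.
Proof.
move=> d_fin dd'; rewrite !B_loss leeB//; apply: ge0_le_integral => //.
- by move=> w _; rewrite lee_fin loss_ge0.
- exact: measurable_loss_X.
- exact: measurable_loss_X.
- by move=> w _; rewrite lee_fin loss_quote_homo.
Qed.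

Lemma L_ge0 n d : 0 <= L n d.
Proof. by rewrite LE; apply: integral_ge0 => w _; rewrite lee_fin excess_ge0. Qed.

Lemma L_stochastic n d : L n d <= L n.+1 d.
Proof.
rewrite !LE; apply: (gamma_stochastic_le mu _ P X _ n (excess^~ d)) => //.
  exact: excess_homo.
by move=> x; exact: excess_ge0.
Qed.

Lemma L_fin_num n d : 0 <= d -> L n d \is a fin_num.
Proof.
move=> d0; rewrite ge0_fin_numE ?L_ge0// LE.
apply: (@le_lt_trans _ _ (\int[P]_w (Num.max (X n w) 0%R)%:E)).
  apply: ge0_le_integral => //.
  - by move=> w _; rewrite lee_fin excess_ge0.
  - exact: measurable_excess_X.
  - by apply/measurable_EFinP; exact: measurable_funrpos.
  - by move=> w _; rewrite lee_fin excess_le_pos.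
by rewrite (mean_gamma mu)// ltry.
Qed.

Lemma mean_loss_lower n d :
  (c * (n.+1%:R / mu))%:E <= mean_loss n d + (l%:E * L n d + (Rv - p)%:E).
Proof.
have mex := measurable_excess_X n d; have mlo := measurable_loss_X n d.
rewrite EFinM -(mean_gamma mu mu_gt0 P X)// -ge0_integralZl_EFin//; last 3 first.
- by move=> w _; rewrite lee_fin le_max lexx orbT.
- by apply/measurable_EFinP; exact: measurable_funrpos.
- exact: ltW.
rewrite LE -ge0_integralZl_EFin//; last first.
  by move=> w _; rewrite lee_fin excess_ge0.
have -> : (Rv - p)%:E = \int[P]_w (cst (Rv - p)%:E w).
  by rewrite integral_cst//= probability_setT mule1.
rewrite -!ge0_integralD//.
- apply: ge0_le_integral => //.
  + move=> w _; rewrite -EFinM lee_fin mulr_ge0 ?(ltW c_gt0)//.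
    by rewrite le_max lexx orbT.
  + by apply: measurable_funeM; apply/measurable_EFinP; exact: measurable_funrpos.
  + apply: emeasurable_funD => //; apply: emeasurable_funD => //.
    exact: measurable_funeM.
  + by move=> w _; rewrite -!EFinM -!EFinD lee_fin loss_lower.
- by move=> w _; rewrite lee_fin loss_ge0.
- move=> w _; rewrite -EFinM -EFinD lee_fin addr_ge0 ?subr_ge0// mulr_ge0//.
  exact: excess_ge0.
- by apply: emeasurable_funD => //; exact: measurable_funeM.
- by move=> w _; rewrite -EFinM lee_fin mulr_ge0// excess_ge0.
- exact: measurable_funeM.
- by move=> w _; rewrite lee_fin subr_ge0.
Qed.

Lemma B_fin_num n d : 0 <= B n d -> B n d \is a fin_num.
Proof.
rewrite B_ge0 B_loss => Br.
by rewrite fin_numB /= ge0_fin_numE ?mean_loss_ge0// (le_lt_trans Br)// ltry.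
Qed.

(** At a finite quote, [loss_shift] bounds the jump of the mean loss by a factor
    tending to one; at [+oo], the mean loss is a monotone limit. *)
Lemma B_ge0_left_closed n s : -oo < s ->
  (forall t : R, t%:E < s -> 0 <= B n t%:E) -> 0 <= B n s.
Proof.
case: s => [s _|_|//] Bt; rewrite B_ge0.
- have shift (e : R) : (0 < e)%R ->
      mean_loss n s%:E <= (expR (r * l * e) / r)%:E.
    move=> e0; have := Bt (s - e)%R;
    rewrite B_ge0 lte_fin ltrBlDr ltrDl => /(_ e0) Be.
    apply: (@le_trans _ _ ((expR (r * l * e))%:E * mean_loss n (s - e)%:E)).
      rewrite -ge0_integralZl_EFin ?expR_ge0//.
      + apply: ge0_le_integral => //.
        * by move=> w _; rewrite lee_fin loss_ge0.
        * exact: measurable_loss_X.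
        * by apply: measurable_funeM; exact: measurable_loss_X.
        * by move=> w _; rewrite -EFinM lee_fin loss_shift// ltW.
      + by move=> w _; rewrite lee_fin loss_ge0.
      + exact: measurable_loss_X.
    by rewrite EFinM lee_wpmul2l// lee_fin expR_ge0.
  have m_ge0 := mean_loss_ge0 n s%:E.
  have m_fin : mean_loss n s%:E \is a fin_num.
    by rewrite ge0_fin_numE// (le_lt_trans (shift _ ltr01))// ltry.
  move: (mean_loss n s%:E) m_fin m_ge0 shift => [m||]// _.
  rewrite lee_fin => m0 shift.
  rewrite lee_fin; apply/ler_addgt0Pr => e e0.
  have k0 : (0 <= r * l * m)%R by rewrite !mulr_ge0// ltW.
  (* [1 - u <= expR (- u)] makes the multiplicative error additive. *)
  pose e' := (e / (r * l * m + 1))%R.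
  have e'0 : (0 < e')%R by rewrite divr_gt0// ltr_wpDl.
  have := shift _ e'0; rewrite lee_fin => me.
  have : (m * expR (- (r * l * e')) <= r^-1)%R.
    rewrite -(@ler_pM2r _ (expR (r * l * e'))) ?expR_gt0//.
    by rewrite -[leLHS]mulrA -expRD addNr expR0 mulr1 mulrC.
  have : (m * (1 - r * l * e') <= m * expR (- (r * l * e')))%R.
    by rewrite ler_wpM2l// expR_ge1Dx.
  have : (r * l * m * e' <= e)%R.
    rewrite /e' mulrA ler_pdivrMr ?ltr_wpDl// mulrDr mulr1 mulrC.
    by rewrite lerDl ltW.
  by lra.
- have : mean_loss n (k%:R)%:E @[k --> \oo] --> mean_loss n +oo.
    rewrite /mean_loss.
    under [in X in _ --> X]eq_integral => w _.
      rewrite (_ : _%:E = limn (fun k => (loss (k%:R)%:E (X n w))%:E)); last first.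
        apply/esym/cvg_lim => //; apply: cvg_near_cst; near=> k.
        by congr EFin; apply: loss_pinfty; rewrite lee_fin; near: k;
          exact: nbhs_infty_ger.
      over.
    apply: cvg_monotone_convergence => //.
    + by move=> k; exact: measurable_loss_X.
    + by move=> k w _; rewrite lee_fin loss_ge0.
    + by move=> w _ j k jk /=; rewrite lee_fin loss_quote_homo ?ltNyr ?lee_fin ?ler_nat.
  move=> cv; rewrite -(cvg_lim _ cv)//; apply: lime_le; first exact: cvgP cv.
  by apply: nearW => k; rewrite -B_ge0 Bt// ltry.
Unshelve. all: by end_near. Qed.

(** By monotonicity the limit is an infimum over finite quotes, which bounds
    [B n +oo] from above, and left-closedness at [+oo] gives the converse. *)
Lemma limB_lt0 n : (lim (B n x%:E @[x --> +oo%R]) < 0) = (B n +oo < 0).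
Proof.
have Bmono : {homo (fun x : R => B n x%:E) : x y / (x <= y)%R >-> y <= x}.
  by move=> x y xy; apply: B_anti_quote; rewrite ?ltNyr ?lee_fin.
rewrite (cvg_lim _ (nonincreasing_cvge Bmono))//; apply/idP/idP.
  apply: le_lt_trans; apply: le_ereal_inf_tmp => _ [x _ <-].
  by apply: B_anti_quote; rewrite ?ltNyr ?leey.
apply: contraTT; rewrite -!leNgt => lim0.
apply: B_ge0_left_closed => // t _; apply: le_trans lim0 _.
by apply: ereal_inf_lbound; exists t.
Qed.

(** Without compensation, joining would force [c * (n + 1) / mu] to stay below a
    constant. *)
Lemma B_pinfty_lt0 : exists n, B n +oo < 0.
Proof.
apply/not_existsP => Bge.
have bnd n : (c * (n.+1%:R / mu) <= r^-1 + (Rv - p))%R.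
  have : 0 <= B n +oo by rewrite leNgt; apply/negP/Bge.
  rewrite B_ge0 => Br; rewrite -lee_fin EFinD; apply: le_trans (leeD Br (lexx _)).
  have := mean_loss_lower n +oo; rewrite LE.
  rewrite integral0_eq ?mule0 ?add0e// => w _.
  by rewrite excess_pinfty.
pose k := Num.truncn ((r^-1 + (Rv - p)) * mu / c).
have := truncnS_gt ((r^-1 + (Rv - p)) * mu / c); rewrite -/k => k_gt.
have := bnd k; rewrite leNgt => /negP; apply.
by rewrite mulrA ltr_pdivlMr// -ltr_pdivrMl// mulrC.
Qed.

(** The accepted quotes form the whole interval below their supremum, which is
    itself accepted by left-closedness. *)
Lemma dP_accepted n d : 0 <= B n 0 -> 0 <= d <= dP X Rv p c l r n -> 0 <= B n d.
Proof.
move=> B0 /andP[d0]; rewrite /dP; have A0 : accepted X Rv p c l r n 0 by [].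
case: ifPn => [/eqP A_eq0|_]; first by move: A0; rewrite A_eq0.
move=> d_sup; apply: B_ge0_left_closed; first exact: lt_le_trans d0.
move=> t /lt_le_trans - /(_ _ d_sup) /ereal_sup_gt[d' [_ Bd'] td'].
by apply: le_trans Bd' _; apply: B_anti_quote; rewrite ?ltNyr// ltW.
Qed.

Lemma accepted_dP n d : 0 <= d -> 0 <= B n d -> d <= dP X Rv p c l r n.
Proof.
move=> d0 Bd; have Ad : accepted X Rv p c l r n d by [].
rewrite /dP; case: ifPn => [/eqP A_eq0|_]; first by move: Ad; rewrite A_eq0.
exact: ereal_sup_ubound.
Qed.

Lemma welfareE n d : 0 <= B n d -> G n d + B n d = p%:E - l%:E * L n d + B n d.
Proof. by rewrite /Defs.G => ->. Qed.

Lemma welfare_fin_num n d : 0 <= d -> 0 <= B n d -> G n d + B n d \is a fin_num.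
Proof.
move=> d0 Bd; rewrite welfareE// fin_numD B_fin_num// andbT.
by rewrite fin_numB/= fin_numM// L_fin_num.
Qed.

(** The compensation is a transfer: what the provider pays on average cancels
    what the bound on the mean loss credits to the customer. *)
Lemma welfare_upper n d : 0 <= d -> 0 <= B n d ->
  G n d + B n d <= (r^-1 + Rv - c * (n.+1%:R / mu))%:E.
Proof.
move=> d0 Bd; rewrite welfareE//; have := mean_loss_lower n d.
have := B_fin_num _ _ Bd; rewrite B_loss.
have := L_fin_num n _ d0.
case: (L n d) => [L' _||]//; case: (mean_loss n d) => [m _||]//.
by rewrite -!EFinM -!EFinD !lee_fin; lra.
Qed.

(** In a lower state the same quote is accepted, pays less compensation and
    leaves the customer better off. *)
Lemma welfare_anti_state n d : 0 <= d -> 0 <= B n.+1 d ->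
  G n.+1 d + B n.+1 d <= G n d + B n d.
Proof.
move=> d0 BS; have Bn : 0 <= B n d by exact: le_trans (B_anti_state n d).
rewrite !welfareE// leeD ?B_anti_state// leeB// lee_wpmul2l ?lee_fin//.
exact: L_stochastic.
Qed.

Local Notation n_over := (n_over X Rv p c l r).
Local Notation n_under := (n_under X Rv p c l r).

Variables (lam : R) (dS : nat -> \bar R).
Hypothesis lam_gt0 : (0 < lam)%R.
Local Notation rho := (lam / mu)%R.

Hypothesis dS_optimal : forall n : nat, (n%:R)%:E < n_over ->
  is_dS X Rv p c l r n (dS n).

Let rho_gt0 : (0 < rho)%R. Proof. exact: divr_gt0. Qed.

Definition best_welfare n : R := fine (G n (dS n) + B n (dS n)).

Local Notation a := best_welfare.

Lemma lt_n_over_B0 n : (n%:R)%:E < n_over -> 0 <= B n 0.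
Proof. by move=> /lt_nat_inf /negP; rewrite -leNgt. Qed.

Lemma dS_accepted n : (n%:R)%:E < n_over -> 0 <= dS n /\ 0 <= B n (dS n).
Proof.
move=> n_lt; have [/[dup] d_in /andP[d0 _] _] := dS_optimal _ n_lt.
split; first exact: d0.
by apply: dP_accepted; [exact: lt_n_over_B0|exact: d_in].
Qed.

Lemma best_welfareE n : (n%:R)%:E < n_over ->
  G n (dS n) + B n (dS n) = (a n)%:E.
Proof.
move=> n_lt; have [d0 Bd] := dS_accepted _ n_lt.
by rewrite fineK//; exact: welfare_fin_num.
Qed.

Lemma welfare_le_best n d : (n%:R)%:E < n_over -> 0 <= d -> 0 <= B n d ->
  G n d + B n d <= (a n)%:E.
Proof.
move=> n_lt d0 Bd; rewrite -best_welfareE//; have [_] := dS_optimal _ n_lt.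
by apply; rewrite d0; exact: accepted_dP.
Qed.

Lemma n_over_ltS n : (n.+1%:R)%:E < n_over -> (n%:R)%:E < n_over.
Proof. by apply: le_lt_trans; rewrite lee_fin ler_nat. Qed.

Lemma best_welfare_anti n : (n.+1%:R)%:E < n_over -> (a n.+1 <= a n)%R.
Proof.
move=> nS_lt; have n_lt := n_over_ltS _ nS_lt.
have [d0 Bd] := dS_accepted _ nS_lt; rewrite -lee_fin -best_welfareE//.
apply: (le_trans (welfare_anti_state _ _ d0 Bd)); apply: welfare_le_best => //.
exact: le_trans (B_anti_state _ _).
Qed.


Local Notation total := (geom_total rho a).
Local Notation weight := (geom_weight rho).
Local Notation marginal := (geom_marginal rho a).
Local Notation Y := (Y X Rv p c l r rho dS).
Local Notation Z := (Z X Rv p c l r rho lam).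

Lemma lt_n_over_leq m n : (m <= n)%N ->
  (n%:R)%:E < n_over -> (m%:R)%:E < n_over.
Proof. by move=> mn; apply: le_lt_trans; rewrite lee_fin ler_nat. Qed.

Lemma YE n : (n%:R)%:E < n_over -> Y n = (marginal n)%:E.
Proof.
move=> n_lt; rewrite /Defs.Y best_welfareE// /geom_marginal EFinB !EFinM.
congr (_ - _ * _); rewrite /geom_total -sumEFin; apply: eq_bigr => k _.
by rewrite best_welfareE -?EFinM//; apply: lt_n_over_leq n_lt; exact: ltnW.
Qed.

Lemma B_pinfty_ge_n_under m : n_under <= (m%:R)%:E -> B m +oo < 0.
Proof.
rewrite /Defs.n_under.
case: (@nat_infP R (fun n => lim (B n x%:E @[x --> +oo%R]) < 0)).
  move=> [n [-> + _]]; rewrite limB_lt0 lee_fin ler_nat => Bn nm.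
  apply: le_lt_trans Bn; elim: m nm => [|m IH]; first by rewrite leqn0 => /eqP->.
  rewrite leq_eqVlt => /predU1P[->//|]; rewrite ltnS => /IH.
  exact: le_trans (B_anti_state _ _).
by move=> [-> _].
Qed.

(** Below the threshold the quotes are unrelated, so the supremum is reached
    state by state; the quote [+oo] in state [m] makes the customer balk. *)
Lemma ZE m : feasible_threshold X Rv p c l r m ->
  Z m = (lam * (total m / weight m))%:E.
Proof.
move=> /andP[under_m m_over].
have lt_over n : (n < m)%N -> (n%:R)%:E < n_over.
  by move=> nm; apply: lt_le_trans m_over; rewrite lte_fin ltr_nat.
have rateE : \sum_(n < m) (q rho n m)%:E * (a n)%:E = (total m / weight m)%:E.
  under eq_bigr => n _ do rewrite -EFinM.
  rewrite sumEFin; congr EFin; rewrite /geom_total mulr_suml.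
  by apply: eq_bigr => n _; rewrite /q mulrAC.
apply/eqP; rewrite eq_le EFinM -rateE; apply/andP; split.
  apply: ge_ereal_sup => _ [d [d_ge0 d_acc _] <-].
  rewrite /social_benefit lee_wpmul2l ?lee_fin ?(ltW lam_gt0)//.
  apply: lee_sum => n _; rewrite lee_wpmul2l//.
    rewrite lee_fin /q divr_ge0 ?exprn_ge0 ?(ltW rho_gt0)//.
    exact/ltW/geom_weight_gt0.
  apply: welfare_le_best; [exact: lt_over|exact/d_ge0/ltnW|exact: d_acc].
apply: ereal_sup_ubound; exists (fun n => if (n < m)%N then dS n else +oo).
  split=> [n nm|n nm|].
  - by case: ifP => // /lt_over/dS_accepted[].
  - by rewrite nm; have [] := dS_accepted _ (lt_over _ nm).
  - by rewrite ltnn; exact: B_pinfty_ge_n_under.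
rewrite /social_benefit; congr (_ * _); apply: eq_bigr => n _.
by rewrite ltn_ord best_welfareE//; exact: lt_over.
Qed.

Lemma marginal_antitone m n : (m <= n)%N -> (n%:R)%:E < n_over ->
  (marginal n <= marginal m)%R.
Proof.
move=> mn n_lt; apply: marginal_anti => // k kn.
by apply: best_welfare_anti; exact: lt_n_over_leq n_lt.
Qed.

(** When [l = c], customers can be insured against any wait, and [n_over] may be
    infinite; the waiting cost still makes the best welfare negative. *)
Lemma marginal_neg : n_over = +oo -> exists n, (marginal n < 0)%R.
Proof.
move=> over_oo; have n_lt n : (n%:R)%:E < n_over by rewrite over_oo ltry.
pose k := Num.truncn ((r^-1 + Rv) * mu / c).
have := truncnS_gt ((r^-1 + Rv) * mu / c); rewrite -/k => k_gt.
exists k; apply: (@le_lt_trans _ _ (a k)).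
  by apply: marginal_le => // j _; exact: best_welfare_anti.
have [d0 Bd] := dS_accepted _ (n_lt k).
have := welfare_upper _ _ d0 Bd; rewrite best_welfareE// lee_fin.
move=> /le_lt_trans; apply.
by rewrite subr_lt0 mulrA ltr_pdivlMr// -ltr_pdivrMl// mulrC.
Qed.

Lemma n_under_le_n_over : n_under <= n_over.
Proof.
apply: ereal_inf_le_tmp => _ [n /= Bn0 <-]; exists n => //=.
rewrite limB_lt0; apply: le_lt_trans Bn0.
by apply: B_anti_quote; rewrite ?leey.
Qed.

Lemma n_under_nat : exists u : nat, n_under = (u%:R)%:E.
Proof.
rewrite /Defs.n_under.
case: (@nat_infP R (fun n => lim (B n x%:E @[x --> +oo%R]) < 0)) =>
  [[u [-> _ _]]|[_ no]].
  by exists u.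
by have [n] := B_pinfty_lt0; rewrite -limB_lt0 => /no.
Qed.

(** The clamp [mine n_tilde n_over] is where the marginal changes sign within
    the states in which a customer can be induced to join. *)
Lemma turning_point : exists w : nat,
  [/\ mine (n_tilde X Rv p c l r rho dS) n_over = (w%:R)%:E,
      forall k, (k < w)%N -> (0 <= marginal k)%R
    & forall k, (w <= k)%N -> (k%:R)%:E < n_over -> (marginal k <= 0)%R].
Proof.
rewrite /n_tilde.
set Q := fun n : nat => _ /\ _.
have [[w [wE [w_lt Yw] w_min]]|[tilde_oo noQ]] := @nat_infP R Q.
  exists w; rewrite wE min_l; last exact: ltW.
  split=> // k wk; last first.
    move=> k_lt; apply: le_trans (marginal_antitone _ _ wk k_lt) _.
    by move: Yw; rewrite YE// lte_fin => /ltW.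
  rewrite leNgt; apply/negP => marg_lt0.
  have k_lt : (k%:R)%:E < n_over by apply: lt_n_over_leq w_lt; exact: ltnW.
  have /w_min : Q k by split=> //; rewrite YE// lte_fin.
  by rewrite leqNgt wk.
have marg_ge0 k : (k%:R)%:E < n_over -> (0 <= marginal k)%R.
  move=> k_lt; rewrite leNgt; apply/negP => marg_lt0.
  by apply: (noQ k); split=> //; rewrite YE// lte_fin.
rewrite tilde_oo minye.
have [[v [vE _ _]]|[over_oo _]] := @nat_infP R (fun n => B n 0 < 0); last first.
  have [k] := marginal_neg over_oo.
  by rewrite ltNge marg_ge0// /Defs.n_over over_oo ltry.
exists v; split=> // k vk.
  by apply: marg_ge0; rewrite /Defs.n_over vE lte_fin ltr_nat.
by rewrite /Defs.n_over vE lte_fin ltr_nat ltnNge vk.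
Qed.

Lemma optimal_threshold : exists nS : nat,
  n_S X Rv p c l r rho dS = (nS%:R)%:E /\
  is_optimal_threshold X Rv p c l r rho lam nS.
Proof.
have [u uE] := n_under_nat; have [w [wE marg_ge0 marg_le0]] := turning_point.
have feas : feasible_threshold X Rv p c l r (maxn u w).
  rewrite /feasible_threshold uE lee_fin ler_nat leq_maxl /=.
  by have [_|_] := leqP w u;
    rewrite -?uE -?wE ?n_under_le_n_over// ge_min lexx orbT.
exists (maxn u w); split.
  rewrite /n_S uE wE -EFin_max; congr EFin.
  by case: leqP => uw; [rewrite max_r|rewrite max_l]; rewrite ?ler_nat// ltnW.
split=> // m feas_m; rewrite !ZE// lee_fin ler_pM2l//.
have /andP[+ m_over] := feas_m; rewrite uE lee_fin ler_nat => um.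
have [mnS|/ltnW nSm] := leqP m (maxn u w).
  apply: rate_le => // k /andP[mk]; rewrite ltnNge geq_max negb_and -!ltnNge.
  by move=> /orP[|/marg_ge0//]; rewrite ltnNge (leq_trans um mk).
apply: rate_ge => // k /andP[nSk km]; apply: marg_le0.
  exact: leq_trans (leq_maxr _ _) nSk.
by apply: lt_le_trans m_over; rewrite lte_fin ltr_nat.
Qed.

End queue.

Theorem proposition7 (disp : measure_display) (T : measurableType disp)
    (R : realType) (P : probability T R) (X : nat -> {RV P >-> R})
    (lam mu Rv p c l r : R) (dS : nat -> \bar R)
    (lam_gt0 : 0 < lam) (mu_gt0 : 0 < mu) (c_gt0 : 0 < c) (r_gt0 : 0 < r)
    (p_bounds : 0 <= p <= Rv) (l_bounds : 0 <= l <= c)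
    (X_gamma : forall (n : nat) (A : set R), measurable A ->
       distribution P (X n) A = gamma_prob n mu A)
    (dS_optimal : forall n : nat, (n%:R%:E < n_over X Rv p c l r)%E ->
       is_dS X Rv p c l r n (dS n)) :
  exists nS : nat,
    n_S X Rv p c l r (lam / mu) dS = nS%:R%:E /\
    is_optimal_threshold X Rv p c l r (lam / mu) lam nS.
Proof.
have /andP[_ pRv] := p_bounds; have /andP[l_ge0 l_le_c] := l_bounds.
exact: (optimal_threshold P X mu).
Qed.
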